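(* Let $(X,\mathcal{A},\mu)$ be a monotone measure space. If $\mu$ is subadditive, then the pan-integral with respect to $\mu$ is linear: for all pan-integrable measurable functions $f,g:X\to\mathbb{R}$ and all $\alpha,\beta\in\mathbb{R}$, the function $\alpha f+\beta g$ is pan-integrable and $$\int^{pan}(\alpha f+\beta g)\,d\mu=\alpha\int^{pan}f\,d\mu+\beta\int^{pan}g\,d\mu.$$
   Context: $X$ is a nonempty set and $\mathcal{A}$ a $\sigma$-algebra of subsets of $X$. A monotone measure on $(X,\mathcal{A})$ is a set function $\mu:\mathcal{A}\to[0,+\infty]$ with $\mu(\emptyset)=0$, $\mu(X)>0$, and $\mu(A)\le\mu(B)$ whenever $A\subset B$, $A,B\in\mathcal{A}$; then $(X,\mathcal{A},\mu)$ is called a monotone measure space. $\mu$ is subadditive if $\mu(A\cup B)\le\mu(A)+\mu(B)$ for all $A,B\in\mathcal{A}$. For a nonnegative real-valued measurable $f$ on $X$, the pan-integral (based on the usual $+$ and $\cdot$) is $$\int^{pan}f\,d\mu=\sup\Big\{\sum_{i=1}^{n}\lambda_i\mu(A_i):\ \sum_{i=1}^{n}\lambda_i\chi_{A_i}\le f,\ \{A_i\}_{i=1}^{n}\subset\mathcal{A}\text{ is a partition of }X,\ \lambda_i\ge 0,\ n\in\mathbb{N}\Big\}\in[0,\infty],$$ where $\chi_A$ is the characteristic function of $A$, a (finite) partition of $X$ is a finite family of pairwise disjoint sets in $\mathcal{A}$ with union $X$, and $0\cdot\infty=0$. For a measurable $f:X\to\mathbb{R}$, put $f^{+}=\max(f,0)$,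 $f^{-}=\max(-f,0)$. If at least one of $\int^{pan}f^{+}d\mu$, $\int^{pan}f^{-}d\mu$ is finite, define $\int^{pan}f\,d\mu=\int^{pan}f^{+}d\mu-\int^{pan}f^{-}d\mu$. If both are finite, $f$ is called pan-integrable. *)

(* Defs.v *)
From HB Require Import structures.
From mathcomp Require Import all_boot all_order all_algebra.
From mathcomp Require Import all_classical all_reals all_analysis.

Set Implicit Arguments.
Unset Strict Implicit.
Unset Printing Implicit Defensive.

Import Order.TTheory GRing.Theory Num.Theory.

Local Open Scope classical_set_scope.
Local Open Scope ring_scope.
Local Open Scope ereal_scope.

(* [mu] is total on [set T], but only its values on measurable sets matter. *)
Record monotone_measure d (T : measurableType d) (R : realType)
    (mu : set T -> \bar R) : Prop := MonotoneMeasure {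
  monotone_measure0 : mu set0 = 0;
  monotone_measure_ge0 : forall A, measurable A -> 0 <= mu A;
  monotone_measureT_gt0 : 0 < mu setT;
  monotone_measure_le : forall A B,
    measurable A -> measurable B -> A `<=` B -> mu A <= mu B }.

Definition subadditive_set_fun d (T : measurableType d) (R : realType)
    (mu : set T -> \bar R) : Prop :=
  forall A B, measurable A -> measurable B -> mu (A `|` B) <= mu A + mu B.

Definition measurable_partition d (T : measurableType d) n
    (A : 'I_n -> set T) : Prop :=
  [/\ forall i, measurable (A i),
      trivIset [set: 'I_n] A &
      \bigcup_(i in [set: 'I_n]) A i = [set: T]].

(* The product of extended reals satisfies [0 * +oo = 0]. *)
Definition pan_sums d (T : measurableType d) (R : realType)
    (mu : set T -> \bar R) (f : T -> R) : set (\bar R) :=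
  [set s | exists (n : nat) (lambda : 'I_n -> R) (A : 'I_n -> set T),
    [/\ measurable_partition A,
        forall i, (0 <= lambda i)%R,
        forall x, (\sum_(i < n) lambda i * \1_(A i) x <= f x)%R &
        s = \sum_(i < n) (lambda i)%:E * mu (A i)]].

Definition pan_integral_nneg d (T : measurableType d) (R : realType)
    (mu : set T -> \bar R) (f : T -> R) : \bar R :=
  ereal_sup (pan_sums mu f).

(* Meaningful only when one of the two terms is finite: [+oo - +oo] is
   the junk value [-oo]. *)
Definition pan_integral d (T : measurableType d) (R : realType)
    (mu : set T -> \bar R) (f : T -> R) : \bar R :=
  pan_integral_nneg mu (f^\+)%R - pan_integral_nneg mu (f^\-)%R.

Definition pan_integrable d (T : measurableType d) (R : realType)
    (mu : set T -> \bar R) (f : T -> R) : Prop :=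
  [/\ measurable_fun [set: T] f,
      pan_integral_nneg mu (f^\+)%R \is a fin_num &
      pan_integral_nneg mu (f^\-)%R \is a fin_num].

(* Main.v *)
Require Import Defs.
From mathcomp Require Import all_boot all_order all_algebra.
From mathcomp Require Import all_classical all_reals all_analysis.
From mathcomp Require Import measurable_realfun ring lra.

(** Write I for the pan-integral of nonnegative functions. The heart of the
    matter is I (f + g) = I f + I g; the rest is the usual passage from
    nonnegative to signed functions. Both inequalities use that, for a
    subadditive mu, refining the partition can only increase a pan-sum: a
    block has measure at most the sum of the measures of its pieces
    ([pan_sum_refine]).

    - I f + I g <= I (f + g): a pan-sum below f and one below g are both
      increased by passing to the common refinement of their partitions, where
      they add up to a single pan-sum below f + g.

    - I (f + g) <= I f + I g: take a pan-sum s of coefficients v_i on blocks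
      C_i, below f + g. Cut each C_i with v_i > 0 into the N + 2 slices on which
      k v_i / (N + 1) <= f < (k + 1) v_i / (N + 1), for k = 0, ..., N, or
      v_i <= f, for k = N + 1. On slice k, f is at least k v_i / (N + 1) and
      g is at least (N - k) v_i / (N + 1), with N - k truncated at 0. These
      coefficients add up to at least v_i N / (N + 1), so the refined
      pan-sums below f and g give s N / (N + 1) <= I f + I g. Since N is
      arbitrary, s <= I f + I g. No convergence theorem is involved, which is
      why finite subadditivity suffices.

    If h = p - q with p, q nonnegative and I p, I q finite, then
    h^+ + q = h^- + p, and additivity of I makes the integral of h equal to
    I p - I q ([pan_integral_diff]). Applied to p = f^+ + g^+ and
    q = f^- + g^- this gives additivity for signed functions; homogeneity
    is direct from I (c f) = c I f for c >= 0, the parts f^+ and f^- being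
    exchanged when c is negative. *)

Set Implicit Arguments.
Unset Strict Implicit.
Unset Printing Implicit Defensive.

Import Order.TTheory GRing.Theory Num.Theory.

Local Open Scope classical_set_scope.
Local Open Scope ring_scope.
Local Open Scope ereal_scope.

(** * Finite partitions over arbitrary finite index types *)

Section finite_partitions.
Context d (T : measurableType d) (R : realType).

(** Indexing by any finite type, rather than by an initial segment of the
    integers, lets a common refinement be indexed by pairs. *)
Definition finite_partition (J : finType) (A : J -> set T) : Prop :=
  [/\ forall j, measurable (A j), trivIset [set: J] A &
      forall x, exists j, A j x].

Lemma finite_partition_fibers (J : finType) (h : T -> J) :
  (forall j, measurable (h @^-1` [set j])) ->
  finite_partition (fun j => h @^-1` [set j]).
Proof.
move=> mh; split=> //; last by move=> x; exists (h x).
by move=> i j _ _ [x [/= <- <-]].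
Qed.

(** The partition [B i] may depend on the block [A i] that it cuts: the slices
    used for the subadditivity of the integral depend on the coefficient
    carried by the block. *)
Lemma finite_partition_refine (I J : finType) (A : I -> set T)
    (B : I -> J -> set T) :
  finite_partition A -> (forall i, finite_partition (B i)) ->
  finite_partition (fun p : I * J => A p.1 `&` B p.1 p.2).
Proof.
move=> [mA tA cA] pB; split=> [[i j]|[i j] [i' j'] _ _|x] /=.
- by have [mB _ _] := pB i; exact: measurableI.
- move=> [x [[Aix Bijx] [Ai'x Bij'x]]].
  have ii' : i = i' by apply: tA => //; exists x.
  move: Bij'x; rewrite -{}ii' => Bij'x.
  have [_ tB _] := pB i.
  by rewrite (tB j j') //; exists x.
have [i Aix] := cA x; have [_ _ /(_ x) [j Bijx]] := pB i.
by exists (i, j).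
Qed.

Lemma measurable_partitionP n (A : 'I_n -> set T) :
  measurable_partition A <-> finite_partition A.
Proof.
split=> [[mA tA UA]|[mA tA cA]]; split=> //.
- by move=> x; have : [set: T] x by []; rewrite -UA => -[i _ Aix]; exists i.
- by apply/seteqP; split=> // x _; have [i Aix] := cA x; exists i.
Qed.

(** Reduces the pointwise comparison of a simple function with [f] to one
    inequality per block. *)
Lemma sum_indic_partition (J : finType) (A : J -> set T) (lam : J -> R) j x :
  trivIset [set: J] A -> A j x -> (\sum_i lam i * \1_(A i) x = lam j)%R.
Proof.
move=> tA Ajx; rewrite (bigD1 j) //= indicE mem_set // mulr1 big1 ?addr0 //.
move=> i /eqP ij; rewrite indicE memNset ?mulr0 // => Aix.
by apply: ij; apply: tA => //; exists x.
Qed.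

End finite_partitions.

(** * Slicing the range of a function into N + 1 levels *)

Section slices.
Context d (T : measurableType d) (R : realType).

(** Superlevel sets of the truncation are superlevel sets of [f] at integers,
    and a fiber is a difference of two of them. *)
Lemma measurable_truncn_min_fiber (f : T -> R) (N m : nat) :
  measurable_fun [set: T] f ->
  measurable [set x | minn N (Num.truncn (f x)) = m].
Proof.
move=> mf.
have mge k : measurable [set x | k <= minn N (Num.truncn (f x))]%N.
  rewrite (_ : [set x | _] =
      if (k <= N)%N then [set x | (k <= Num.truncn (f x))%N] else set0); last first.
    by apply/seteqP; split=> x /=; rewrite leq_min; case: ifP.
  case: ifP => // _; case: k => [|k].
    by rewrite (_ : [set x | _] = setT) //; apply/seteqP; split.
  under eq_set do rewrite truncn_gt_nat.
  rewrite -[X in measurable X]setTI.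
  have := @measurable_fun_ler _ _ R setT (cst k.+1%:R) f (measurable_cst _) mf.
  by move=> /(_ measurableT [set true] I); rewrite preimage_true.
rewrite (_ : [set x | _] = [set x | m <= minn N (Num.truncn (f x))]%N `\`
    [set x | m.+1 <= minn N (Num.truncn (f x))]%N); first exact: measurableD.
apply/seteqP; split=> x /=; first by move->; rewrite ltnn leqnn.
by move=> [mk /negP]; rewrite -leqNgt => km; apply/eqP; rewrite eqn_leq km.
Qed.

(** The level of [a] relative to [v] is the number of multiples of
    [v / N.+1] in [(0, a]], capped at [N.+1]. For [v = 0] the quotient is 0 by
    convention, hence so is the level, and both bounds below are trivial. *)
Lemma truncn_slice_le (N : nat) (a v : R) : (0 <= a)%R -> (0 <= v)%R ->
  ((minn N.+1 (Num.truncn (N.+1%:R * a / v)))%:R / N.+1%:R * v <= a)%R.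
Proof.
move=> a0; rewrite le_eqVlt => /predU1P[<-|v0]; first by rewrite mulr0.
rewrite mulrAC ler_pdivrMr // -ler_pdivlMr // [(a * _)%R]mulrC.
apply: (@le_trans _ _ (Num.truncn (N.+1%:R * a / v))%:R%R).
  by rewrite ler_nat geq_minr.
by rewrite truncn_le divr_ge0 ?mulr_ge0 // ltW.
Qed.

(** When the level [k] is less than [N], [a < k.+1 * v / N.+1], so [b] makes up
    for the remaining [N - k] steps; otherwise the truncated difference
    vanishes. *)
Lemma truncn_slice_compl_le (N : nat) (a b v : R) : (0 <= b)%R -> (0 <= v)%R ->
  (v <= a + b)%R ->
  ((N - minn N.+1 (Num.truncn (N.+1%:R * a / v)))%:R / N.+1%:R * v <= b)%R.
Proof.
move=> b0; rewrite le_eqVlt => /predU1P[<-|v0] vab; first by rewrite mulr0.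
set k := Num.truncn _.
have [Nk|kN] := leqP N k.
  by rewrite (_ : (_ - _)%N = 0%N) ?mul0r //; apply/eqP;
    rewrite subn_eq0 leq_min leqnSn.
rewrite (minn_idPr (leqW (ltnW kN))) (natrB _ (ltnW kN)).
have := truncnS_gt (N.+1%:R * a / v)%R; rewrite -/k ltr_pdivrMr // => ltk.
rewrite mulrAC ler_pdivrMr //.
have NS : (N.+1%:R = N%:R + 1 :> R)%R by rewrite -natr1.
have kS : (k.+1%:R = k%:R + 1 :> R)%R by rewrite -natr1.
have N0 : (0 < N.+1%:R :> R)%R by [].
have : (N.+1%:R * v <= N.+1%:R * (a + b))%R by rewrite ler_pM2l.
move: ltk; rewrite kS NS; lra.
Qed.

End slices.

(** * The pan-integral of nonnegative functions *)

Section pan_integral_nneg.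
Context d (T : measurableType d) (R : realType) (mu : set T -> \bar R).
Hypothesis mu_monotone : monotone_measure mu.

Local Notation I := (pan_integral_nneg mu).

Lemma pan_sum_le (J : finType) (lam : J -> R) (A : J -> set T) (f : T -> R) :
  finite_partition A -> (forall j, 0 <= lam j)%R ->
  (forall j x, A j x -> lam j <= f x)%R ->
  \sum_j (lam j)%:E * mu (A j) <= I f.
Proof.
move=> [mA tA cA] lam0 lamf; apply: ereal_sup_ubound.
have pA : finite_partition (fun i : 'I_#|J| => A (enum_val i)).
  split=> [//|i j _ _ Aij|x]; first by apply: enum_val_inj; exact: tA.
  by have [j Ajx] := cA x; exists (enum_rank j); rewrite enum_rankK.
exists #|J|, (fun i => lam (enum_val i)), (fun i => A (enum_val i)).
split=> [|//|x|//]; first exact/measurable_partitionP.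
- have [_ tA' /(_ x) [i Aix]] := pA.
  by rewrite (sum_indic_partition (lam \o enum_val) tA' Aix); exact: lamf.
- by rewrite (reindex (@enum_val J J)) //; apply: onW_bij; exact: enum_val_bij.
Qed.

Lemma pan_integral_nneg_le (f : T -> R) (M : \bar R) :
  (forall n (lam : 'I_n -> R) (A : 'I_n -> set T),
    finite_partition A -> (forall i, 0 <= lam i)%R ->
    (forall i x, A i x -> lam i <= f x)%R ->
    \sum_i (lam i)%:E * mu (A i) <= M) ->
  I f <= M.
Proof.
move=> fM; apply: ge_ereal_sup => _ [n [lam [A [pA lam0 lamf ->]]]].
have pA' := (measurable_partitionP A).1 pA.
apply: fM => // i x Aix; have [_ tA _] := pA'.
by rewrite -(sum_indic_partition lam tA Aix).
Qed.

Lemma pan_sum_ge0 (J : finType) (lam : J -> R) (A : J -> set T) :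
  finite_partition A -> (forall j, 0 <= lam j)%R ->
  0 <= \sum_j (lam j)%:E * mu (A j).
Proof.
move=> [mA _ _] lam0; apply: sume_ge0 => j _.
by rewrite mule_ge0 ?lee_fin ?(monotone_measure_ge0 mu_monotone).
Qed.

Lemma pan_integral_nneg_ge0 (f : T -> R) : (forall x, 0 <= f x)%R -> 0 <= I f.
Proof.
move=> f0; have pT : finite_partition (fun _ : unit => [set: T]).
  by split=> [//|[] []|x] //; exists tt.
have := pan_sum_le (lam := fun=> 0%R) pT (fun=> lexx _) (fun _ x _ => f0 x).
by rewrite big1 // => i _; rewrite mul0e.
Qed.

Lemma le_pan_integral_nneg (f g : T -> R) :
  (forall x, f x <= g x)%R -> I f <= I g.
Proof.
move=> fg; apply: pan_integral_nneg_le => n lam A pA lam0 lamf.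
by apply: pan_sum_le => // i x Aix; rewrite (le_trans _ (fg x)) ?(lamf i).
Qed.

Lemma pan_integral_nneg0 : I (cst 0%R) = 0.
Proof.
apply/eqP; rewrite eq_le pan_integral_nneg_ge0 ?andbT; last by move=> x.
apply: pan_integral_nneg_le => n lam A pA lam0 lamf.
rewrite big1 // => i _; have [->|/set0P[x Aix]] := eqVneq (A i) set0.
  by rewrite (monotone_measure0 mu_monotone) mule0.
suff -> : lam i = 0%R by rewrite mul0e.
by apply/eqP; rewrite eq_le lam0 (lamf i x).
Qed.

Lemma pan_integral_nnegZ (c : R) (f : T -> R) : (0 <= c)%R ->
  (forall x, 0 <= f x)%R -> I (fun x => c * f x)%R = c%:E * I f.
Proof.
(* Both inequalities follow from this one, used for c and for its inverse. *)
move=> c0 f0; have le_cI (b : R) (h : T -> R) :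
    (0 < b)%R -> b%:E * I h <= I (fun x => b * h x)%R.
  move=> b0; rewrite -lee_pdivlMl //.
  apply: pan_integral_nneg_le => n lam A pA lam0 lamh.
  rewrite lee_pdivlMl // ge0_sume_distrr; last first.
    move=> i _; have [mA _ _] := pA.
    by rewrite mule_ge0 ?lee_fin ?(monotone_measure_ge0 mu_monotone).
  under eq_bigr do rewrite muleA -EFinM.
  apply: pan_sum_le => // [i|i x Aix]; first by rewrite mulr_ge0 // ltW.
  by rewrite ler_pM2l // (lamh i).
move: c0; rewrite le_eqVlt => /predU1P[<-|c0].
  by under eq_fun do rewrite mul0r; rewrite mul0e pan_integral_nneg0.
apply/eqP; rewrite eq_le le_cI // andbT -lee_pdivrMl //.
rewrite (le_trans (le_cI _ _ _)) ?invr_gt0 //.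
by apply: le_pan_integral_nneg => x; rewrite mulKf // gt_eqF.
Qed.

Hypothesis mu_subadditive : subadditive_set_fun mu.

Lemma subadditive_seq_cover (J : eqType) (r : seq J) (A : set T)
    (B : J -> set T) :
  measurable A -> (forall j, measurable (B j)) ->
  (forall x, A x -> exists2 j, j \in r & B j x) ->
  mu A <= \sum_(j <- r) mu (A `&` B j).
Proof.
move=> + mB; elim: r A => [|j r IH] A mA cA.
  have -> : A = set0 by apply/seteqP; split=> // x /cA[].
  by rewrite big_nil (monotone_measure0 mu_monotone).
rewrite big_cons -[in leLHS](setUIDK A (B j)).
have mAj : measurable (A `\` B j) by exact: measurableD.
apply: (le_trans (mu_subadditive _ mAj)); first exact: measurableI.
rewrite leeD2l //; apply: (le_trans (IH _ mAj _)).
  move=> x [Ax nBjx]; have [k] := cA x Ax.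
  by rewrite inE => /predU1P[-> //|kr Bkx]; exists k.
apply: lee_sum => k _; apply: (monotone_measure_le mu_monotone).
- exact: measurableI.
- exact: measurableI.
- by move=> x [[]].
Qed.

(** This is how subadditivity of [mu] enters the estimates: each block is covered
    by its pieces. *)
Lemma pan_sum_refine (J K : finType) (lam : J -> R) (A : J -> set T)
    (B : J -> K -> set T) :
  finite_partition A -> (forall j, finite_partition (B j)) ->
  (forall j, 0 <= lam j)%R ->
  \sum_j (lam j)%:E * mu (A j) <=
  \sum_(p : J * K) (lam p.1)%:E * mu (A p.1 `&` B p.1 p.2).
Proof.
move=> [mA _ _] pB lam0.
rewrite -(pair_bigA _ (fun j k => (lam j)%:E * mu (A j `&` B j k))) /=.
apply: lee_sum => j _; have [mB _ cB] := pB j.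
rewrite -ge0_sume_distrr; last first.
  by move=> k _; apply: (monotone_measure_ge0 mu_monotone); exact: measurableI.
rewrite lee_wpmul2l ?lee_fin //; apply: subadditive_seq_cover => // x _.
by have [k Bkx] := cB x; exists k => //; rewrite mem_index_enum.
Qed.

(** On the common refinement, a pan-sum below [f] and one below [g] add up to a
    pan-sum below [f + g]. *)
Lemma pan_integral_nneg_superadditive (f g : T -> R) :
  (forall x, 0 <= f x)%R -> (forall x, 0 <= g x)%R ->
  I f + I g <= I (fun x => f x + g x)%R.
Proof.
move=> f0 g0; set M := (X in _ <= X).
have sumM n m (lam : 'I_n -> R) A (nu : 'I_m -> R) B :
    finite_partition A -> (forall i, 0 <= lam i)%R ->
    (forall i x, A i x -> lam i <= f x)%R ->
    finite_partition B -> (forall i, 0 <= nu i)%R ->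
    (forall i x, B i x -> nu i <= g x)%R ->
    \sum_i (lam i)%:E * mu (A i) + \sum_j (nu j)%:E * mu (B j) <= M.
  move=> pA lam0 lamf pB nu0 nug.
  have pAB := finite_partition_refine pA (fun=> pB).
  have leA := pan_sum_refine pA (fun=> pB) lam0.
  have := pan_sum_refine pB (fun=> pA) nu0.
  rewrite (reindex (fun p => (p.2, p.1))) /=; last first.
    by exists (fun p => (p.2, p.1)) => -[].
  under [leRHS]eq_bigr do rewrite setIC.
  move=> /(leeD leA) /le_trans; apply.
  rewrite -big_split /=.
  under eq_bigr => p _ do rewrite -ge0_muleDl ?lee_fin // -EFinD.
  apply: (pan_sum_le (lam := fun p : 'I_n * 'I_m => lam p.1 + nu p.2)%R) => //.
    by move=> p; rewrite addr_ge0.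
  by move=> [i j] x [/= Aix Bjx]; rewrite lerD ?(lamf i) ?(nug j).
(* To pass from pan-sums to the suprema, each term is moved in turn to the
   other side, which requires the terms to be finite. *)
have [->|MNy] := eqVneq M +oo; first exact: leey.
have M0 : 0 <= M by apply: pan_integral_nneg_ge0 => x; rewrite addr_ge0.
have Mfin : M \is a fin_num by rewrite ge0_fin_numE // ltey.
have If_fin : I f \is a fin_num.
  rewrite ge0_fin_numE ?pan_integral_nneg_ge0 //.
  apply: (@le_lt_trans _ _ M); last by rewrite ltey.
  by apply: le_pan_integral_nneg => x; rewrite lerDl.
rewrite addeC -leeBrDr //; apply: pan_integral_nneg_le => m nu B pB nu0 nug.
rewrite leeBrDr // addeC.
have s0 := pan_sum_ge0 pB nu0.
have sM : \sum_i (nu i)%:E * mu (B i) <= M.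
  by apply: pan_sum_le => // i x Bix; rewrite (le_trans (nug _ _ Bix)) ?lerDr.
have sfin : \sum_i (nu i)%:E * mu (B i) \is a fin_num.
  by rewrite ge0_fin_numE // (le_lt_trans sM) // ltey.
rewrite -leeBrDr //; apply: pan_integral_nneg_le => n lam A pA lam0 lamf.
by rewrite leeBrDr //; exact: sumM.
Qed.

(** A pan-sum below [f + g] is split, up to a factor close to 1, into one below
    [f] and one below [g] by slicing its blocks along the values of [f]. *)
Lemma pan_integral_nneg_subadditive (f g : T -> R) :
  measurable_fun [set: T] f ->
  (forall x, 0 <= f x)%R -> (forall x, 0 <= g x)%R ->
  I (fun x => f x + g x)%R <= I f + I g.
Proof.
move=> mf f0 g0; apply: pan_integral_nneg_le => n v C pC v0 vfg.
apply/lee_mul01Pr => [|r /andP[r0 r1]]; first exact: pan_sum_ge0.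
(* It suffices to bound r times the pan-sum for every r < 1, which leaves room
   for the loss of one step out of N + 1 in the slicing. *)
have [N rN] : exists N, (r <= N%:R / N.+1%:R)%R.
  exists (Num.truncn (1 - r)^-1%R).
  have := truncnS_gt (1 - r)^-1%R; set N := Num.truncn _ => ltN.
  have r'0 : (0 < 1 - r)%R by rewrite subr_gt0.
  rewrite ler_pdivlMr //.
  move: ltN; rewrite -(ltr_pM2r r'0) mulVf ?gt_eqF // -natr1; lra.
pose level i x := minn N.+1 (Num.truncn (N.+1%:R * f x / v i)%R).
have level_lt i x : (level i x < N.+2)%N by rewrite ltnS geq_minl.
pose h i x := Ordinal (level_lt i x).
have pS i : finite_partition (fun k => h i @^-1` [set k]).
  apply: finite_partition_fibers => k.
  rewrite (_ : h i @^-1` _ = [set x | level i x = k]); last first.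
    apply/seteqP; split=> x /=; first by move=> <-.
    by move=> hk; exact: val_inj.
  apply: measurable_truncn_min_fiber.
  by apply: measurable_funM => //; exact: measurable_funM.
have pCS := finite_partition_refine pC pS.
pose lam (p : 'I_n * 'I_N.+2) := (p.2%:R / N.+1%:R * v p.1)%R.
pose nu (p : 'I_n * 'I_N.+2) := ((N - p.2)%:R / N.+1%:R * v p.1)%R.
have lam0 p : (0 <= lam p)%R by rewrite !mulr_ge0.
have nu0 p : (0 <= nu p)%R by rewrite !mulr_ge0.
have lamf : \sum_p (lam p)%:E * mu (C p.1 `&` h p.1 @^-1` [set p.2]) <= I f.
  apply: (pan_sum_le pCS) => // -[i k] x [/= Cix <-].
  exact: truncn_slice_le.
have nug : \sum_p (nu p)%:E * mu (C p.1 `&` h p.1 @^-1` [set p.2]) <= I g.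
  apply: (pan_sum_le pCS) => // -[i k] x [/= Cix <-].
  by apply: truncn_slice_compl_le => //; exact: vfg.
apply: le_trans (leeD lamf nug); rewrite -big_split /=.
have rv0 j : (0 <= r * v j)%R by rewrite mulr_ge0 // ltW.
rewrite ge0_sume_distrr; last first.
  move=> i _; have [mC _ _] := pC.
  by rewrite mule_ge0 ?lee_fin ?(monotone_measure_ge0 mu_monotone).
under [leLHS]eq_bigr do rewrite muleA -EFinM.
apply: (le_trans (pan_sum_refine pC pS rv0)).
apply: lee_sum => p _; rewrite -ge0_muleDl ?lee_fin // -EFinD.
have [mCS _ _] := pCS.
apply: lee_wpmul2r; first exact/(monotone_measure_ge0 mu_monotone)/mCS.
rewrite lee_fin /lam /nu -!mulrDl ler_wpM2r // (le_trans rN) //.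
by rewrite ler_pM2r ?invr_gt0 // -natrD ler_nat -leq_subLR.
Qed.

Lemma pan_integral_nnegD (f g : T -> R) :
  measurable_fun [set: T] f ->
  (forall x, 0 <= f x)%R -> (forall x, 0 <= g x)%R ->
  I (fun x => f x + g x)%R = I f + I g.
Proof.
move=> mf f0 g0; apply/eqP; rewrite eq_le.
by rewrite pan_integral_nneg_subadditive // pan_integral_nneg_superadditive.
Qed.

(** * Linearity for signed functions *)

(** From [h^+ - h^- = p - q] one gets [h^+ + q = h^- + p], to which additivity
    applies; [h^+ <= p] and [h^- <= q] provide the finiteness needed to
    subtract. *)
Lemma pan_integral_diff (p q h : T -> R) :
  measurable_fun [set: T] p -> measurable_fun [set: T] q ->
  (forall x, 0 <= p x)%R -> (forall x, 0 <= q x)%R ->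
  I p \is a fin_num -> I q \is a fin_num ->
  (forall x, h x = p x - q x)%R ->
  pan_integrable mu h /\ pan_integral mu h = I p - I q.
Proof.
move=> mp mq p0 q0 Ip Iq hE.
have mh : measurable_fun [set: T] h.
  by rewrite (_ : h = p \- q)%R; [exact: measurable_funB|exact/funext].
have hp_le : I (h^\+)%R <= I p.
  by apply: le_pan_integral_nneg => x; rewrite /funrpos ge_max p0 hE gerBl q0.
have hn_le : I (h^\-)%R <= I q.
  by apply: le_pan_integral_nneg => x;
    rewrite /funrneg ge_max q0 hE opprB gerBl p0.
have Ihp : I (h^\+)%R \is a fin_num.
  rewrite ge0_fin_numE; last exact/pan_integral_nneg_ge0/funrpos_ge0.
  by rewrite (le_lt_trans hp_le) // ltey_eq Ip.
have Ihn : I (h^\-)%R \is a fin_num.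
  rewrite ge0_fin_numE; last exact/pan_integral_nneg_ge0/funrneg_ge0.
  by rewrite (le_lt_trans hn_le) // ltey_eq Iq.
split; first by split.
have : I (h^\+)%R + I q = I (h^\-)%R + I p.
  rewrite -!pan_integral_nnegD //; try by [exact: measurable_funrpos|
    exact: measurable_funrneg|exact: funrpos_ge0|exact: funrneg_ge0].
  congr I; apply/funext => x.
  have : (h^\+ x - h^\- x = h x)%R by have /(congr1 (@^~ x)) := funrposBneg h.
  rewrite hE; lra.
rewrite /pan_integral -(fineK Ihp) -(fineK Ihn) -(fineK Ip) -(fineK Iq).
by rewrite -!EFinD => -[e]; congr EFin; lra.
Qed.

Lemma pan_integralD (f g : T -> R) :
  pan_integrable mu f -> pan_integrable mu g ->
  pan_integrable mu (fun x => f x + g x)%R /\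
  pan_integral mu (fun x => f x + g x)%R = pan_integral mu f + pan_integral mu g.
Proof.
move=> [mf fp fn] [mg gp gn].
have pD := pan_integral_nnegD (measurable_funrpos mf) (funrpos_ge0 f) (funrpos_ge0 g).
have nD := pan_integral_nnegD (measurable_funrneg mf) (funrneg_ge0 f) (funrneg_ge0 g).
have [||||||x|intD valD] := @pan_integral_diff (fun x => f^\+ x + g^\+ x)%R
    (fun x => f^\- x + g^\- x)%R (fun x => f x + g x)%R.
- by apply: measurable_funD; exact: measurable_funrpos.
- by apply: measurable_funD; exact: measurable_funrneg.
- by move=> x; rewrite addr_ge0 ?funrpos_ge0.
- by move=> x; rewrite addr_ge0 ?funrneg_ge0.
- by rewrite pD fin_numD fp.
- by rewrite nD fin_numD fn.
- have /(congr1 (@^~ x)) /= := funrposBneg f.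
  have /(congr1 (@^~ x)) /= := funrposBneg g.
  rewrite !fctE; lra.
split=> //; rewrite valD pD nD /pan_integral.
rewrite -(fineK fp) -(fineK fn) -(fineK gp) -(fineK gn) -!EFinD.
by congr EFin; lra.
Qed.

Lemma pan_integralZ (c : R) (f : T -> R) : pan_integrable mu f ->
  pan_integrable mu (fun x => c * f x)%R /\
  pan_integral mu (fun x => c * f x)%R = c%:E * pan_integral mu f.
Proof.
move=> [mf fp fn].
have mcf : measurable_fun [set: T] (fun x => c * f x)%R by exact: measurable_funM.
have [c0|/ltW c0] := leP 0%R c.
  have Zp := pan_integral_nnegZ c0 (funrpos_ge0 f).
  have Zn := pan_integral_nnegZ c0 (funrneg_ge0 f).
  rewrite /pan_integrable /pan_integral ge0_funrposM // ge0_funrnegM // Zp Zn.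
  rewrite -(fineK fp) -(fineK fn) -!EFinM; split=> //.
  by congr EFin; lra.
have c'0 : (0 <= - c)%R by rewrite oppr_ge0.
have Zp := pan_integral_nnegZ c'0 (funrpos_ge0 f).
have Zn := pan_integral_nnegZ c'0 (funrneg_ge0 f).
rewrite /pan_integrable /pan_integral le0_funrposM // le0_funrnegM // Zp Zn.
rewrite -(fineK fp) -(fineK fn) -!EFinM; split=> //.
by congr EFin; lra.
Qed.

End pan_integral_nneg.

Theorem theorem5p1 (d : measure_display) (T : measurableType d) (R : realType)
    (mu : set T -> \bar R)
    (mu_monotone : monotone_measure mu)
    (mu_subadditive : subadditive_set_fun mu)
    (f g : T -> R)
    (f_integrable : pan_integrable mu f)
    (g_integrable : pan_integrable mu g)
    (alpha beta : R) :
  pan_integrable mu (fun x => alpha * f x + beta * g x)%R /\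
  pan_integral mu (fun x => alpha * f x + beta * g x)%R =
    (alpha%:E * pan_integral mu f + beta%:E * pan_integral mu g)%E.
Proof.
have [af <-] := pan_integralZ mu_monotone alpha f_integrable.
have [bg <-] := pan_integralZ mu_monotone beta g_integrable.
exact: pan_integralD.
Qed.
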